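(* Let $a<b$ be real numbers and let $f:[a,b]\to\mathbb{R}$ be continuous on $[a,b]$ and differentiable on $(a,b)$ with bounded first derivative, i.e. $\|f'\|_\infty:=\sup_{t\in(a,b)}|f'(t)|<\infty$. For $\lambda,\mu\in[0,1]$ and $x\in\left[a,\frac{a+b}{2}\right]$ put $$E(f;\lambda,\mu;x):=\frac{1}{b-a}\int_a^b f(t)\,dt-\left\{\lambda\frac{f(a)+f(b)}{2}+(1-\lambda)\left[\mu f(x)+(1-\mu)f(a+b-x)\right]\right\}$$ and $\nu_2(\lambda,\mu):=a+(b-a)\left(\frac{\lambda}{2}+\mu(1-\lambda)\right)$. Then for all $\lambda,\mu\in[0,1]$ and $x\in\left[a,\frac{a+b}{2}\right]$, $$|E(f;\lambda,\mu;x)|\le \frac{C(x,\lambda,\mu)}{2(b-a)}\,\|f'\|_\infty,$$ where, for $x\in\left[a,a+\lambda\frac{b-a}{2}\right]$, $$C(x,\lambda,\mu):=2\lambda(x-a)(b-a)-2(x-a)^2+(x-\nu_2(\lambda,\mu))^2+(a+b-x-\nu_2(\lambda,\mu))^2,$$ and, for $x\in\left[a+\lambda\frac{b-a}{2},\frac{a+b}{2}\right]$, $$C(x,\lambda,\mu):=(x-a)^2+\left[\lambda(b-a)-(x-a)\right]^2+\tilde C(x,\lambda,\mu),$$ with $$\tilde C(x,\lambda,\mu):=\begin{cases}(x-\nu_2(\lambda,\mu))^2+(a+b-x-\nu_2(\lambda,\mu))^2, & \mu\in[0,\tfrac12],\ x\le\nu_2(\lambda,\mu),\\ -(x-\nu_2(\lambda,\mu))^2+(a+b-x-\nu_2(\lambda,\mu))^2,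 & \mu\in[0,\tfrac12],\ x>\nu_2(\lambda,\mu),\\ (x-\nu_2(\lambda,\mu))^2+(a+b-x-\nu_2(\lambda,\mu))^2, & \mu\in(\tfrac12,1],\ x\le a+b-\nu_2(\lambda,\mu),\\ (x-\nu_2(\lambda,\mu))^2-(a+b-x-\nu_2(\lambda,\mu))^2, & \mu\in(\tfrac12,1],\ x>a+b-\nu_2(\lambda,\mu).\end{cases}$$
   Context: All objects are defined in the claim. (At the common endpoint $x=a+\lambda\frac{b-a}{2}$ the two formulas for $C(x,\lambda,\mu)$ agree.) *)

(* Defs.v *)
From Stdlib Require Import Reals.
From Coquelicot Require Import Coquelicot.
From Stdlib Require Import Lra.
Open Scope R_scope.

(* A function on [a, b] is represented by a total [f : R -> R], whose values
   outside [a, b] are irrelevant to everything below. *)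

(* Supremum of |f'| over the open interval, as an extended real.  When [f] is
   differentiable on (a, b), [Derive f t] there depends only on [f] in (a, b). *)
Definition sup_norm_deriv (f : R -> R) (a b : R) : Rbar :=
  Lub_Rbar (fun y => exists t, a < t < b /\ y = Rabs (Derive f t)).

Definition quad_err (a b : R) (f : R -> R) (lambda mu x : R) : R :=
  1 / (b - a) * RInt f a b
  - (lambda * ((f a + f b) / 2)
     + (1 - lambda) * (mu * f x + (1 - mu) * f (a + b - x))).

Definition nu2 (a b lambda mu : R) : R :=
  a + (b - a) * (lambda / 2 + mu * (1 - lambda)).

Definition C_tilde (a b x lambda mu : R) : R :=
  let nu := nu2 a b lambda mu in
  if Rle_dec mu (1 / 2) then
    if Rle_dec x nu
    then (x - nu) ^ 2 + (a + b - x - nu) ^ 2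
    else - (x - nu) ^ 2 + (a + b - x - nu) ^ 2
  else
    if Rle_dec x (a + b - nu)
    then (x - nu) ^ 2 + (a + b - x - nu) ^ 2
    else (x - nu) ^ 2 - (a + b - x - nu) ^ 2.

Definition C_left (a b x lambda mu : R) : R :=
  2 * lambda * (x - a) * (b - a) - 2 * (x - a) ^ 2
  + (x - nu2 a b lambda mu) ^ 2 + (a + b - x - nu2 a b lambda mu) ^ 2.

Definition C_right (a b x lambda mu : R) : R :=
  (x - a) ^ 2 + (lambda * (b - a) - (x - a)) ^ 2 + C_tilde a b x lambda mu.

(* The common endpoint is given to the first formula; by [C_endpoint] the second
   one takes the same value there. *)
Definition C_const (a b x lambda mu : R) : R :=
  if Rle_dec x (a + lambda * ((b - a) / 2))
  then C_left a b x lambda mu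
  else C_right a b x lambda mu.

Lemma C_endpoint (a b lambda mu : R) :
  a < b -> 0 <= lambda <= 1 -> 0 <= mu <= 1 ->
  let x := a + lambda * ((b - a) / 2) in
  C_left a b x lambda mu = C_right a b x lambda mu.
Proof.
intros Hab Hl Hm x.
assert (H1 : 0 <= (b - a) * (mu * (1 - lambda))).
{ apply Rmult_le_pos; [lra | apply Rmult_le_pos; lra]. }
assert (H2 : 0 <= (b - a) * ((1 - mu) * (1 - lambda))).
{ apply Rmult_le_pos; [lra | apply Rmult_le_pos; lra]. }
assert (Hx : x <= nu2 a b lambda mu) by (unfold x, nu2; lra).
assert (Hx' : x <= a + b - nu2 a b lambda mu) by (unfold x, nu2; lra).
unfold C_left, C_right, C_tilde; cbv zeta.
destruct (Rle_dec x (nu2 a b lambda mu)); [|contradiction].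
destruct (Rle_dec x (a + b - nu2 a b lambda mu)); [|contradiction].
destruct (Rle_dec mu (1 / 2)); unfold x, nu2; field.
Qed.

(* Main.v *)
Require Import Defs.
From Stdlib Require Import Reals.
From Coquelicot Require Import Coquelicot.
From Stdlib Require Import Lra Psatz.
Open Scope R_scope.

(** The function is M-Lipschitz with M = sup |f'|, by the mean value theorem.
    The rule is the sum of three generalized trapezoid rules
    (c - u) f(u) + (v - c) f(v) on [a, x], [x, a+b-x] and [a+b-x, b], with
    respective nodes c = a + lambda (b-a)/2, nu2 and b - lambda (b-a)/2.  Each
    has error at most M times the integral of |t - c| over [u, v]; when c lies
    outside [u, v] the rule is an endpoint rectangle rule plus a multiple of
    f(v) - f(u).  Adding the three kernel integrals gives C / 2. *)

Definition lipschitz (M : R) (f : R -> R) : Prop :=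
  forall s t, Rabs (f s - f t) <= M * Rabs (s - t).

(** Composing [f] with [clamp a b] extends it from [a, b] by its boundary values, so continuity and
    the Lipschitz bound hold on all of R and the integral estimates carry no interval conditions. *)
Definition clamp (a b t : R) : R := Rmax a (Rmin b t).

Lemma clamp_id (a b t : R) : a <= t <= b -> clamp a b t = t.
Proof. intros Ht; unfold clamp; rewrite Rmin_right, Rmax_right; lra. Qed.

Lemma clamp_bounds (a b t : R) : a <= b -> a <= clamp a b t <= b.
Proof.
intros Hab; unfold clamp, Rmax, Rmin.
destruct (Rle_dec b t); destruct (Rle_dec a _); lra.
Qed.

Lemma clamp_contraction (a b s t : R) :
  a <= b -> Rabs (clamp a b s - clamp a b t) <= Rabs (s - t).
Proof.
intros Hab; unfold clamp, Rmax, Rmin.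
destruct (Rle_dec b t), (Rle_dec b s); repeat destruct (Rle_dec a _);
  unfold Rabs; repeat destruct (Rcase_abs _); lra.
Qed.

Lemma continuous_clamp (a b : R) (f : R -> R) :
  a <= b -> continuous_on (fun t => a <= t <= b) f ->
  forall t, continuous (fun t => f (clamp a b t)) t.
Proof.
intros Hab Hf t.
(* Continuity of [f] is relative to [a, b]; since [clamp a b] takes values there, its limit can be
   taken along the [within] filter. *)
apply (filterlim_comp _ _ _ (clamp a b) f _
         (within (fun s => a <= s <= b) (locally (clamp a b t)))).
- intros P [e He].
  exists e; intros s Hs; apply He.
  + apply Rle_lt_trans with (2 := Hs).
    exact (clamp_contraction a b s t Hab).
  + now apply clamp_bounds.
- apply Hf; now apply clamp_bounds.
Qed.

Lemma lipschitz_clamp (a b M : R) (f : R -> R) :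
  a < b -> continuous_on (fun t => a <= t <= b) f ->
  (forall t, a < t < b -> ex_derive f t) ->
  (forall t, a < t < b -> Rabs (Derive f t) <= M) ->
  lipschitz M (fun t => f (clamp a b t)).
Proof.
intros Hab Hf Hd HM.
assert (M_ge0 : 0 <= M).
{ apply Rle_trans with (2 := HM ((a + b) / 2) ltac:(lra)); apply Rabs_pos. }
enough (H : forall s t, a <= s <= b -> a <= t <= b ->
              Rabs (f s - f t) <= M * Rabs (s - t)).
{ intros s t.
  apply Rle_trans with (M * Rabs (clamp a b s - clamp a b t)).
  - apply H; apply clamp_bounds; lra.
  - apply Rmult_le_compat_l; [assumption | apply clamp_contraction; lra]. }
intros s t Hs Ht.
rewrite <- (clamp_id a b s) at 1 by assumption.
rewrite <- (clamp_id a b t) at 1 by assumption.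
(* [MVT_gen] places the mean value point in the closed interval, where [f] need
   not be differentiable, so the derivative is set to 0 off (a, b). *)
pose (df z := if Rlt_dec a z then if Rlt_dec z b then Derive f z else 0 else 0).
assert (df_le : forall z, Rabs (df z) <= M).
{ intros z; unfold df.
  destruct (Rlt_dec a z); [destruct (Rlt_dec z b) |];
    rewrite ?Rabs_R0; auto. }
destruct (MVT_gen (fun t => f (clamp a b t)) t s df) as [z [_ ->]].
- intros z Hz.
  assert (Hz' : a < z < b).
  { revert Hz; unfold Rmin, Rmax; destruct (Rle_dec t s); lra. }
  unfold df; destruct (Rlt_dec a z); [| lra]; destruct (Rlt_dec z b); [| lra].
  apply is_derive_ext_loc with f; [| now apply Derive_correct, Hd].
  assert (Ho : locally z (fun y => a < y /\ y < b)).
  { apply (open_and _ _ (open_gt a) (open_lt b)); lra. }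
  apply filter_imp with (2 := Ho); intros y Hy; rewrite clamp_id; lra.
- intros z _; apply continuity_pt_filterlim.
  apply (continuous_clamp a b f); [lra | assumption].
- rewrite Rabs_mult; apply Rmult_le_compat_r; [apply Rabs_pos | apply df_le].
Qed.

(** Integrate |f t - f p| <= M |t - p| for p = u and p = v; at an endpoint, t - p has constant sign
    on [u, v]. *)
Lemma rectangle_rule_error (M : R) (f : R -> R) (u v : R) :
  lipschitz M f -> (forall t, continuous f t) -> u <= v ->
  Rabs (RInt f u v - (v - u) * f u) <= M * (v - u) ^ 2 / 2 /\
  Rabs (RInt f u v - (v - u) * f v) <= M * (v - u) ^ 2 / 2.
Proof.
intros f_lip f_cont Huv.
assert (f_int : ex_RInt f u v)
  by (apply (@ex_RInt_continuous R_CompleteNormedModule); auto).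
assert (Hdiff : forall p, is_RInt (fun t => f t - f p) u v
                            (RInt f u v - (v - u) * f p)).
{ intros p.
  apply (is_RInt_minus f (fun _ => f p)).
  - now apply (@RInt_correct R_CompleteNormedModule).
  - apply (is_RInt_const u v (f p)). }
assert (Hprim : forall p, is_RInt (fun t => M * (t - p)) u v
                  (M * (v - p) ^ 2 / 2 - M * (u - p) ^ 2 / 2)).
{ intros p.
  apply (is_RInt_derive (fun t => M * (t - p) ^ 2 / 2)).
  - intros t _; auto_derive; [trivial | field].
  - intros t _; apply (ex_derive_continuous (fun t => M * (t - p))).
    auto_derive; trivial. }
split.
- replace (M * (v - u) ^ 2 / 2)
    with (M * (v - u) ^ 2 / 2 - M * (u - u) ^ 2 / 2) by field.
  refine (norm_RInt_le _ _ u v _ _ Huv _ (Hdiff u) (Hprim u)).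
  intros t Ht; rewrite <- (Rabs_right (t - u)) by lra; apply f_lip.
- replace (M * (v - u) ^ 2 / 2)
    with (- (M * (v - v) ^ 2 / 2 - M * (u - v) ^ 2 / 2)) by field.
  refine (norm_RInt_le _ _ u v _ _ Huv _ (Hdiff v) (is_RInt_opp _ _ _ _ (Hprim v))).
  intros t Ht; change (Rabs (f t - f v) <= - (M * (t - v))).
  replace (- (M * (t - v))) with (M * - (t - v)) by ring.
  rewrite <- (Rabs_left1 (t - v)) by lra; apply f_lip.
Qed.

(* [t * |t| / 2] is the primitive of [|t|], so the bound is [M] times the
   integral of [|t - c|] over [u, v]. *)
Lemma trapezoid_rule_error (M : R) (f : R -> R) (u v c : R) :
  lipschitz M f -> (forall t, continuous f t) -> u <= v ->
  Rabs (RInt f u v - ((c - u) * f u + (v - c) * f v))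
    <= M / 2 * ((c - u) * Rabs (c - u) + (v - c) * Rabs (v - c)).
Proof.
intros f_lip f_cont Huv.
assert (Hend := f_lip v u); rewrite (Rabs_right (v - u)) in Hend by lra.
destruct (Rle_dec u c) as [Huc | Huc]; [destruct (Rle_dec c v) as [Hcv | Hcv] |].
(* For c in [u, v], the rule is a left rectangle on [u, c] plus a right rectangle on [c, v]. *)
- destruct (rectangle_rule_error M f u c f_lip f_cont Huc) as [Hl _].
  destruct (rectangle_rule_error M f c v f_lip f_cont Hcv) as [_ Hr].
  assert (Hch : RInt f u c + RInt f c v = RInt f u v).
  { apply (@RInt_Chasles R_CompleteNormedModule f);
      apply (@ex_RInt_continuous R_CompleteNormedModule); auto. }
  rewrite (Rabs_right (c - u)), (Rabs_right (v - c)) by lra.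
  apply Rabs_le_between in Hl; apply Rabs_le_between in Hr.
  apply Rabs_le_between; lra.
(* For c > v, the rule is (v - u) f(u) - (c - v) (f(v) - f(u)), and (v - u)^2 + 2 (c - v) (v - u) =
   (c - u)^2 - (c - v)^2. *)
- destruct (rectangle_rule_error M f u v f_lip f_cont Huv) as [Hl _].
  rewrite (Rabs_right (c - u)), (Rabs_left (v - c)) by lra.
  apply (Rmult_le_compat_l (c - v)) in Hend; [| lra].
  rewrite <- (Rabs_right (c - v)) in Hend at 1 by lra.
  rewrite <- Rabs_mult in Hend.
  apply Rabs_le_between in Hl; apply Rabs_le_between in Hend.
  apply Rabs_le_between; lra.
(* Symmetrically, for c < u the rule is (v - u) f(v) + (u - c) (f(v) - f(u)). *)
- destruct (rectangle_rule_error M f u v f_lip f_cont Huv) as [_ Hr].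
  rewrite (Rabs_left (c - u)), (Rabs_right (v - c)) by lra.
  apply (Rmult_le_compat_l (u - c)) in Hend; [| lra].
  rewrite <- (Rabs_right (u - c)) in Hend at 1 by lra.
  rewrite <- Rabs_mult in Hend.
  apply Rabs_le_between in Hr; apply Rabs_le_between in Hend.
  apply Rabs_le_between; lra.
Qed.

(** The cases of [C_const] only record the signs of x - (a + d), nu - x and a + b - x - nu. The
    factor 2 counts the two outer intervals, which are mirror images. *)
Lemma C_const_kernel (a b x lambda mu : R) :
  a < b -> 0 <= lambda <= 1 -> 0 <= mu <= 1 -> a <= x <= (a + b) / 2 ->
  let d := lambda * ((b - a) / 2) in
  let nu := nu2 a b lambda mu in
  C_const a b x lambda mu =
    2 * (d * Rabs d + (x - (a + d)) * Rabs (x - (a + d)))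
    + ((nu - x) * Rabs (nu - x) + (a + b - x - nu) * Rabs (a + b - x - nu)).
Proof.
intros Hab Hl Hm Hx d nu.
assert (H1 : 0 <= (b - a) * (mu * (1 - lambda))).
{ apply Rmult_le_pos; [lra | apply Rmult_le_pos; lra]. }
assert (H2 : 0 <= (b - a) * ((1 - mu) * (1 - lambda))).
{ apply Rmult_le_pos; [lra | apply Rmult_le_pos; lra]. }
assert (Hd : 0 <= d) by (apply Rmult_le_pos; lra).
assert (Hnu : a + d <= nu <= b - d) by (unfold nu, nu2, d; lra).
(* The sign of mu - 1/2 tells on which side of the midpoint [nu] lies, hence which of nu - x and a +
   b - x - nu is surely nonnegative. *)
assert (Hmid : nu - (a + b) / 2 = (mu - 1 / 2) * ((1 - lambda) * (b - a))).
{ unfold nu, nu2; field. }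
assert (Hlb : 0 <= (1 - lambda) * (b - a)) by (apply Rmult_le_pos; lra).
rewrite (Rabs_right d) by lra.
unfold C_const, C_left, C_right, C_tilde; fold nu; fold d; cbv zeta.
replace (lambda * (b - a)) with (2 * d) by (unfold d; field).
replace (2 * lambda * (x - a) * (b - a)) with (4 * d * (x - a))
  by (unfold d; field).
destruct (Rle_dec x (a + d)).
(* Here x <= a + d <= nu <= b - d <= a + b - x, so [nu] lies in the middle interval. *)
{ rewrite (Rabs_left1 (x - (a + d))), (Rabs_right (nu - x)),
    (Rabs_right (a + b - x - nu)) by lra; ring. }
rewrite (Rabs_right (x - (a + d))) by lra.
destruct (Rle_dec mu (1 / 2)).
- assert (nu <= (a + b) / 2) by nra.
  rewrite (Rabs_right (a + b - x - nu)) by lra.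
  destruct (Rle_dec x nu);
    [rewrite (Rabs_right (nu - x)) by lra | rewrite (Rabs_left (nu - x)) by lra];
    ring.
- assert ((a + b) / 2 <= nu) by nra.
  rewrite (Rabs_right (nu - x)) by lra.
  destruct (Rle_dec x (a + b - nu));
    [rewrite (Rabs_right (a + b - x - nu)) by lra
    | rewrite (Rabs_left (a + b - x - nu)) by lra];
    ring.
Qed.

Lemma quad_err_lipschitz (a b M : R) (f : R -> R) (lambda mu x : R) :
  a < b -> lipschitz M f -> (forall t, continuous f t) ->
  0 <= lambda <= 1 -> 0 <= mu <= 1 -> a <= x <= (a + b) / 2 ->
  Rabs (quad_err a b f lambda mu x)
    <= C_const a b x lambda mu / (2 * (b - a)) * M.
Proof.
intros Hab f_lip f_cont Hl Hm Hx.
rewrite C_const_kernel by assumption; cbv zeta.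
set (d := lambda * ((b - a) / 2)); set (nu := nu2 a b lambda mu).
assert (E1 := trapezoid_rule_error M f a x (a + d) f_lip f_cont ltac:(lra)).
assert (E2 := trapezoid_rule_error M f x (a + b - x) nu f_lip f_cont ltac:(lra)).
assert (E3 := trapezoid_rule_error M f (a + b - x) b (b - d) f_lip f_cont
                ltac:(lra)).
replace (a + d - a) with d in E1 by ring.
replace (b - d - (a + b - x)) with (x - (a + d)) in E3 by ring.
replace (b - (b - d)) with d in E3 by ring.
assert (f_int : forall u v, ex_RInt f u v)
  by (intros; apply (@ex_RInt_continuous R_CompleteNormedModule); auto).
assert (Hch1 : RInt f a x + RInt f x (a + b - x) = RInt f a (a + b - x))
  by (apply (@RInt_Chasles R_CompleteNormedModule f); auto).
assert (Hch2 : RInt f a (a + b - x) + RInt f (a + b - x) b = RInt f a b)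
  by (apply (@RInt_Chasles R_CompleteNormedModule f); auto).
apply (Rmult_le_reg_l (b - a)); [lra |].
rewrite <- (Rabs_right (b - a)) at 1 by lra; rewrite <- Rabs_mult.
(* The weights of adjacent rules add up: nu - (a + d) = (b - a) mu (1 - lambda) at x, and (b - d) -
   nu = (b - a) (1 - mu) (1 - lambda) at a + b - x. *)
replace ((b - a) * quad_err a b f lambda mu x)
  with ((RInt f a x - (d * f a + (x - (a + d)) * f x))
        + (RInt f x (a + b - x)
           - ((nu - x) * f x + (a + b - x - nu) * f (a + b - x)))
        + (RInt f (a + b - x) b
           - ((x - (a + d)) * f (a + b - x) + d * f b))).
- apply Rle_trans with (1 := Rabs_triang _ _).
  apply Rle_trans with (1 := Rplus_le_compat_r _ _ _ (Rabs_triang _ _)).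
  apply Rle_trans with (1 := Rplus_le_compat _ _ _ _
                               (Rplus_le_compat _ _ _ _ E1 E2) E3).
  right; field; lra.
- unfold quad_err; rewrite <- Hch2, <- Hch1; unfold nu, nu2, d; field; lra.
Qed.

Lemma quad_err_clamp (a b : R) (f : R -> R) (lambda mu x : R) :
  a <= x <= b ->
  quad_err a b (fun t => f (clamp a b t)) lambda mu x = quad_err a b f lambda mu x.
Proof.
intros Hx; unfold quad_err.
rewrite !clamp_id by lra.
rewrite (RInt_ext (fun t => f (clamp a b t)) f); [reflexivity |].
intros t; rewrite Rmin_left, Rmax_right by lra; intros Ht.
rewrite clamp_id; lra.
Qed.

Lemma Derive_le_sup_norm (f : R -> R) (a b t : R) :
  Rbar_lt (sup_norm_deriv f a b) p_infty -> a < t < b ->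
  Rabs (Derive f t) <= real (sup_norm_deriv f a b).
Proof.
unfold sup_norm_deriv; intros Hfin Ht.
assert (H := proj1 (Lub_Rbar_correct
  (fun y => exists t, a < t < b /\ y = Rabs (Derive f t)))
  _ (ex_intro _ t (conj Ht eq_refl))).
(* [real] sends infinite values to 0, so both must be excluded: [p_infty] by [Hfin], [m_infty]
   because the set contains a real number. *)
destruct (Lub_Rbar _); simpl in *; [assumption | contradiction..].
Qed.

Theorem theorem5 :
  forall (a b : R) (f : R -> R),
    a < b ->
    continuous_on (fun t => a <= t <= b) f ->
    (forall t, a < t < b -> ex_derive f t) ->
    Rbar_lt (sup_norm_deriv f a b) p_infty ->
    forall lambda mu x : R,
      0 <= lambda <= 1 ->
      0 <= mu <= 1 ->
      a <= x <= (a + b) / 2 ->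
      Rabs (quad_err a b f lambda mu x)
        <= C_const a b x lambda mu / (2 * (b - a)) * real (sup_norm_deriv f a b).
Proof.
intros a b f Hab Hf Hd Hfin lambda mu x Hl Hm Hx.
rewrite <- quad_err_clamp by lra.
apply quad_err_lipschitz; try assumption.
- apply lipschitz_clamp; try assumption.
  intros t Ht; now apply Derive_le_sup_norm.
- apply continuous_clamp; [lra | assumption].
Qed.
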